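(* Let $M$ be a hemi-slant submanifold of a cosymplectic manifold $N$, with $TM = D^{\theta}\oplus D^{\perp}\oplus\langle\xi\rangle$. Then the anti-invariant distribution $D^{\perp}$ is integrable if and only if $$T\nabla_{Z}W = T\nabla_{W}Z$$ for all $Z,W\in D^{\perp}$.
   Context: An almost contact metric manifold is a $(2m+1)$-dimensional manifold $N$ with structure $(\phi,\xi,\eta,g)$, where $\phi$ is a $(1,1)$-tensor field, $\xi$ a vector field, $\eta$ a one-form and $g$ a Riemannian metric, satisfying $\phi^2=-I+\eta\otimes\xi$, $\eta(\xi)=1$, $g(\phi X,\phi Y)=g(X,Y)-\eta(X)\eta(Y)$; consequently $\phi\xi=0$, $\eta(\phi X)=0$, $\eta(X)=g(X,\xi)$, $g(\phi X,Y)+g(X,\phi Y)=0$. A normal almost contact metric manifold $N$ with Levi-Civita connection $\overline{\nabla}$ is called cosymplectic if $\overline{\nabla}_X\phi=0$ and $\overline{\nabla}_X\xi=0$ for all $X$. $M$ is a submanifold of $N$ with $\xi$ tangent to $M$, equipped with the induced metric; $\nabla$ is the induced connection on $M$. For $X$ tangent to $M$ write $\phi X=TX+FX$ with $TX$ tangent and $FX$ normal to $M$. $M$ is a hemi-slant submanifold if there are two orthogonal distributions $D^{\theta}$, $D^{\perp}$ on $M$ such that (i) $TM=D^{\theta}\oplus D^{\perp}\oplus\langle\xi\rangle$ (orthogonal sum), where $\langle\xi\rangle$ is the distribution spanned by $\xi$; (ii) $D^{\theta}$ is a slant distribution with slant angle $\theta\neq\frac{\pi}{2}$, i.e. for every $x\in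 M$ and every nonzero $X\in D^{\theta}_x$ the angle in $[0,\frac{\pi}{2}]$ between $\phi X$ and $T_xM$ equals the constant $\theta$; (iii) $D^{\perp}$ is totally real (anti-invariant), i.e. $\phi D^{\perp}\subseteq T^{\perp}M$. *)

(* Defs.v *)
From HB Require Import structures.
From mathcomp Require Import all_boot all_order all_algebra.
From mathcomp Require Import all_classical all_reals all_analysis.

Set Implicit Arguments.
Unset Strict Implicit.
Unset Printing Implicit Defensive.

Import Order.TTheory GRing.Theory Num.Theory.
Import numFieldNormedType.Exports.

Local Open Scope classical_set_scope.
Local Open Scope ring_scope.

(* f is C^k on the open set A: iterated directional derivatives ['d f a v] exist
   up to order k and are continuous. For finite-dimensional E, fixing the
   direction v at each step is the same as differentiating the map 'd f. *)
Fixpoint Ck (R : realType) (E F : normedModType R) (k : nat) (A : set E)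
    (f : E -> F) : Prop :=
  if k is j.+1 then
    (forall a, A a -> differentiable f a) /\
    (forall v : E, Ck j A (fun a => 'd f a v))
  else forall a, A a -> {for a, continuous f}.

Definition smooth_at (R : realType) (E F : normedModType R) (f : E -> F)
    (a : E) : Prop :=
  exists2 A : set E, open_nbhs a A & forall k, Ck k A f.

(* A smooth n-manifold. The atlas is indexed by the points: [chart p] is a
   chart around p, with domain [dom p] and inverse [ichart p] (both functions
   are total, their values outside [dom p] and its image are irrelevant). Any
   atlas can be presented in this way by selecting a chart around each point;
   the smooth structure is the one generated by the atlas. *)
Record manifold (R : realType) (n : nat) := Manifold {
  point_of :> topologicalType;
  manifold_hausdorff : hausdorff_space point_of;
  manifold_second_countable : @second_countable point_of;
  dom : point_of -> set point_of;
  chart : point_of -> point_of -> 'rV[R]_n;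
  ichart : point_of -> 'rV[R]_n -> point_of;
  dom_nbhs : forall p, open_nbhs p (dom p);
  chart_open : forall p, open (chart p @` dom p);
  chartK : forall p q, dom p q -> ichart p (chart p q) = q;
  chart_continuous : forall p q, dom p q -> {for q, continuous (chart p)};
  ichart_continuous :
    forall p q, dom p q -> {for chart p q, continuous (ichart p)};
  transition_smooth : forall p q r, dom p r -> dom q r ->
    smooth_at (chart q \o ichart p) (chart p r)
}.

(* The tangent space T_pM is 'rV[R]_n: a tangent vector at p is represented by
   its components in the chart [chart p]. A vector field is thus a function
   X : M -> 'rV[R]_n, where X q is read in [chart q]; the components of a
   tangent vector at q in the chart around p are given by the Jacobian of the
   transition map. *)
Section Manifold.
Context {R : realType} {n : nat} {M : manifold R n}.

Definition components (p q : M) (v : 'rV[R]_n) : 'rV[R]_n :=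
  'd (chart p \o ichart q) (chart q q) v.

Definition in_chart (X : M -> 'rV[R]_n) (p : M) (a : 'rV[R]_n) : 'rV[R]_n :=
  components p (ichart p a) (X (ichart p a)).

Definition fun_smooth_at (f : M -> R) (p : M) : Prop :=
  smooth_at (f \o ichart p : 'rV[R]_n -> R^o) (chart p p).

Definition vf_smooth_at (X : M -> 'rV[R]_n) (p : M) : Prop :=
  smooth_at (in_chart X p) (chart p p).

(* v(f), for v in T_pM *)
Definition dfun (p : M) (f : M -> R) (v : 'rV[R]_n) : R :=
  'd (f \o ichart p : 'rV[R]_n -> R^o) (chart p p) v.

(* [X, Y]^i = X^j d_j Y^i - Y^j d_j X^i *)
Definition lie_bracket (X Y : M -> 'rV[R]_n) (p : M) : 'rV[R]_n :=
  'd (in_chart Y p) (chart p p) (X p) - 'd (in_chart X p) (chart p p) (Y p).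

(* A distribution of constant rank, locally spanned by smooth vector fields
   (rank 0 is allowed). *)
Definition is_distribution (D : M -> {vspace 'rV[R]_n}) : Prop :=
  exists r : nat, forall p, exists U : set M, exists X : 'I_r -> M -> 'rV[R]_n,
    [/\ open_nbhs p U,
        forall i q, U q -> vf_smooth_at (X i) q &
        forall q, U q -> \dim (D q) = r /\ D q = <<[seq X i q | i : 'I_r]>>%VS].

Definition section_on (U : set M) (D : M -> {vspace 'rV[R]_n})
    (X : M -> 'rV[R]_n) : Prop :=
  forall p, U p -> vf_smooth_at X p /\ X p \in D p.

(* Integrability is meant in the sense of closure under the Lie bracket
   (involutivity); sections are local, over an arbitrary open set. *)
Definition integrable_distribution (D : M -> {vspace 'rV[R]_n}) : Prop :=
  forall (U : set M) (Z W : M -> 'rV[R]_n), open U ->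
    section_on U D Z -> section_on U D W ->
    forall p, U p -> lie_bracket Z W p \in D p.

(* Tensors at p, in the basis given by [chart p]: a (1,1)-tensor is a matrix
   acting on the right of row vectors, a one-form is a column vector and a
   bilinear form is given by its Gram matrix. *)
Definition app11 (A : M -> 'M[R]_n) (p : M) (u : 'rV[R]_n) : 'rV[R]_n :=
  u *m A p.

Definition app1 (w : M -> 'cV[R]_n) (p : M) (u : 'rV[R]_n) : R :=
  (u *m w p) 0 0.

Definition app2 (g : M -> 'M[R]_n) (p : M) (u v : 'rV[R]_n) : R :=
  (u *m g p *m v^T) 0 0.

Record riemannian_metric (g : M -> 'M[R]_n) : Prop := {
  metric_sym : forall p u v, app2 g p u v = app2 g p v u;
  metric_pos : forall p u, u != 0 -> 0 < app2 g p u u;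
  metric_smooth : forall p X Y, vf_smooth_at X p -> vf_smooth_at Y p ->
    fun_smooth_at (fun q => app2 g q (X q) (Y q)) p
}.

(* A linear connection, given on vector fields defined near a point:
   [nab p v Y] is the derivative at p of Y in the direction v in T_pM. It is
   only constrained for Y smooth on a neighbourhood of p. The Leibniz rule,
   applied to a function that is 1 near p and vanishes elsewhere, makes it
   depend on the germ of Y at p only. *)
Record is_connection (nab : M -> 'rV[R]_n -> (M -> 'rV[R]_n) -> 'rV[R]_n)
    : Prop := {
  connection_smooth : forall p X Y, vf_smooth_at X p -> vf_smooth_at Y p ->
    vf_smooth_at (fun q => nab q (X q) Y) p;
  connection_linear : forall p a u v Y, vf_smooth_at Y p ->
    nab p (a *: u + v) Y = a *: nab p u Y + nab p v Y;
  connection_add : forall p v X Y, vf_smooth_at X p -> vf_smooth_at Y p ->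
    nab p v (fun q => X q + Y q) = nab p v X + nab p v Y;
  connection_leibniz : forall p v f Y, fun_smooth_at f p -> vf_smooth_at Y p ->
    nab p v (fun q => f q *: Y q) = dfun p f v *: Y p + f p *: nab p v Y
}.

Record levi_civita (g : M -> 'M[R]_n)
    (nab : M -> 'rV[R]_n -> (M -> 'rV[R]_n) -> 'rV[R]_n) : Prop := {
  levi_civita_connection : is_connection nab;
  levi_civita_metric : forall p v Y Z, vf_smooth_at Y p -> vf_smooth_at Z p ->
    dfun p (fun q => app2 g q (Y q) (Z q)) v =
      app2 g p (nab p v Y) (Z p) + app2 g p (Y p) (nab p v Z);
  levi_civita_torsion : forall p X Y, vf_smooth_at X p -> vf_smooth_at Y p ->
    nab p (X p) Y - nab p (Y p) X = lie_bracket X Y p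
}.

Record almost_contact_metric (phi : M -> 'M[R]_n) (xi : M -> 'rV[R]_n)
    (eta : M -> 'cV[R]_n) (g : M -> 'M[R]_n) : Prop := {
  acm_phi_smooth : forall p X, vf_smooth_at X p ->
    vf_smooth_at (fun q => app11 phi q (X q)) p;
  acm_xi_smooth : forall p, vf_smooth_at xi p;
  acm_eta_smooth : forall p X, vf_smooth_at X p ->
    fun_smooth_at (fun q => app1 eta q (X q)) p;
  acm_riemannian : riemannian_metric g;
  acm_phi2 : forall p u,
    app11 phi p (app11 phi p u) = - u + app1 eta p u *: xi p;
  acm_eta_xi : forall p, app1 eta p (xi p) = 1;
  acm_compatible : forall p u v,
    app2 g p (app11 phi p u) (app11 phi p v) =
      app2 g p u v - app1 eta p u * app1 eta p v
}.

(* Normality: [phi, phi] + 2 d eta (x) xi = 0, where [phi, phi] is the Nijenhuis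
   torsion of phi and 2 d eta(X, Y) = X(eta(Y)) - Y(eta(X)) - eta([X, Y]). *)
Definition normal_structure (phi : M -> 'M[R]_n) (xi : M -> 'rV[R]_n)
    (eta : M -> 'cV[R]_n) : Prop :=
  forall p X Y, vf_smooth_at X p -> vf_smooth_at Y p ->
    let phiX := fun q => app11 phi q (X q) in
    let phiY := fun q => app11 phi q (Y q) in
    app11 phi p (app11 phi p (lie_bracket X Y p)) + lie_bracket phiX phiY p
      - app11 phi p (lie_bracket phiX Y p) - app11 phi p (lie_bracket X phiY p)
      + (dfun p (fun q => app1 eta q (Y q)) (X p)
         - dfun p (fun q => app1 eta q (X q)) (Y p)
         - app1 eta p (lie_bracket X Y p)) *: xi p = 0.

Record cosymplectic (phi : M -> 'M[R]_n) (xi : M -> 'rV[R]_n)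
    (eta : M -> 'cV[R]_n) (g : M -> 'M[R]_n)
    (nab : M -> 'rV[R]_n -> (M -> 'rV[R]_n) -> 'rV[R]_n) : Prop := {
  cosymplectic_acm : almost_contact_metric phi xi eta g;
  cosymplectic_normal : normal_structure phi xi eta;
  cosymplectic_levi_civita : levi_civita g nab;
  cosymplectic_phi : forall p v Y, vf_smooth_at Y p ->
    nab p v (fun q => app11 phi q (Y q)) = app11 phi p (nab p v Y);
  cosymplectic_xi : forall p v, nab p v xi = 0
}.

End Manifold.

Section Submanifold.
Context {R : realType} {k n : nat} {M : manifold R k} {N : manifold R n}.
Implicit Types (iota : M -> N) (g phi : N -> 'M[R]_n) (xi : N -> 'rV[R]_n).

Definition tangent_map iota (p : M) (u : 'rV[R]_k) : 'rV[R]_n :=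
  'd (chart (iota p) \o iota \o ichart p) (chart p p) u.

(* M is an (immersed) submanifold of N through the inclusion iota, and T_pM is
   identified with its image under the tangent map. *)
Record is_submanifold iota : Prop := {
  submanifold_inj : injective iota;
  submanifold_continuous : continuous iota;
  submanifold_smooth : forall p,
    smooth_at (chart (iota p) \o iota \o ichart p) (chart p p);
  submanifold_immersion : forall p, injective (tangent_map iota p)
}.

Definition is_normal iota g (p : M) (V : 'rV[R]_n) : Prop :=
  forall w : 'rV[R]_k, app2 g (iota p) V (tangent_map iota p w) = 0.

Definition induced_metric iota g (p : M) (u v : 'rV[R]_k) : R :=
  app2 g (iota p) (tangent_map iota p u) (tangent_map iota p v).

(* tangential part of V in T_{iota p}N *)
Definition tan_part iota g (p : M) (V : 'rV[R]_n) : 'rV[R]_k :=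
  get [set u | is_normal iota g p (V - tangent_map iota p u)].

(* TX, the tangential part of phi X *)
Definition Tmap iota phi g (p : M) (u : 'rV[R]_k) : 'rV[R]_k :=
  tan_part iota g p (app11 phi (iota p) (tangent_map iota p u)).

(* Smoothness of a vector field V of N along M. *)
Definition along_smooth_at iota (V : M -> 'rV[R]_n) (p : M) : Prop :=
  smooth_at (fun a : 'rV[R]_k =>
    components (iota p) (iota (ichart p a)) (V (ichart p a))) (chart p p).

(* The pullback connection, i.e. nab acting on vector fields of N along M: the
   connection of the bundle iota^* TN such that the derivative of Y \o iota in
   the direction v is [nab] of Y in the direction of the image of v. *)
Record is_pullback_connection iota
    (nab : N -> 'rV[R]_n -> (N -> 'rV[R]_n) -> 'rV[R]_n)
    (nabM : M -> 'rV[R]_k -> (M -> 'rV[R]_n) -> 'rV[R]_n) : Prop := {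
  pullback_smooth : forall p X V,
    vf_smooth_at X p -> along_smooth_at iota V p ->
    along_smooth_at iota (fun q => nabM q (X q) V) p;
  pullback_linear : forall p a u v V, along_smooth_at iota V p ->
    nabM p (a *: u + v) V = a *: nabM p u V + nabM p v V;
  pullback_add : forall p v V W,
    along_smooth_at iota V p -> along_smooth_at iota W p ->
    nabM p v (fun q => V q + W q) = nabM p v V + nabM p v W;
  pullback_leibniz : forall p v f V,
    fun_smooth_at f p -> along_smooth_at iota V p ->
    nabM p v (fun q => f q *: V q) = dfun p f v *: V p + f p *: nabM p v V;
  pullback_restrict : forall p v Y, vf_smooth_at Y (iota p) ->
    nabM p v (Y \o iota) = nab (iota p) (tangent_map iota p v) Y
}.

(* The induced connection on M (Gauss formula): the tangential part of the
   ambient derivative of Y in the direction X. *)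
Definition induced_connection iota g
    (nabM : M -> 'rV[R]_k -> (M -> 'rV[R]_n) -> 'rV[R]_n)
    (X Y : M -> 'rV[R]_k) (p : M) : 'rV[R]_k :=
  tan_part iota g p (nabM p (X p) (fun q => tangent_map iota q (Y q))).

Definition xi_tangent iota xi : Prop :=
  forall p, exists u, tangent_map iota p u = xi (iota p).

(* Angle in [0, pi/2] between a nonzero V in T_{iota p}N and T_pM, that is the
   angle between V and its orthogonal projection on T_pM:
   cos = |tan V| / |V|. *)
Definition angle_with_tangent iota g (p : M) (V : 'rV[R]_n) : R :=
  let u := tan_part iota g p V in
  acos (Num.sqrt (induced_metric iota g p u u) /
        Num.sqrt (app2 g (iota p) V V)).

Record hemi_slant iota phi xi g (Dtheta Dperp : M -> {vspace 'rV[R]_k})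
    (theta : R) : Prop := {
  hemi_slant_Dtheta : is_distribution Dtheta;
  hemi_slant_Dperp : is_distribution Dperp;
  hemi_slant_sum : forall p,
    (Dtheta p + Dperp p + <[tan_part iota g p (xi (iota p))]>)%VS = fullv;
  hemi_slant_orth : forall p u v, u \in Dtheta p -> v \in Dperp p ->
    induced_metric iota g p u v = 0;
  hemi_slant_Dtheta_xi : forall p u, u \in Dtheta p ->
    app2 g (iota p) (tangent_map iota p u) (xi (iota p)) = 0;
  hemi_slant_Dperp_xi : forall p v, v \in Dperp p ->
    app2 g (iota p) (tangent_map iota p v) (xi (iota p)) = 0;
  hemi_slant_theta : 0 <= theta <= pi / 2;
  hemi_slant_theta_neq : theta <> pi / 2;
  hemi_slant_slant : forall p u, u \in Dtheta p -> u != 0 ->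
    angle_with_tangent iota g p (app11 phi (iota p) (tangent_map iota p u))
      = theta;
  hemi_slant_totally_real : forall p v, v \in Dperp p ->
    is_normal iota g p (app11 phi (iota p) (tangent_map iota p v))
}.

End Submanifold.

(* Main.v *)
Require Import Defs.
From HB Require Import structures.
From mathcomp Require Import all_boot all_order all_algebra.
From mathcomp Require Import all_classical all_reals all_analysis.
From mathcomp Require Import ring lra.

Set Implicit Arguments.
Unset Strict Implicit.
Unset Printing Implicit Defensive.

Import Order.TTheory GRing.Theory Num.Theory.
Import numFieldNormedType.Exports.

Local Open Scope classical_set_scope.
Local Open Scope ring_scope.

(** The induced connection is torsion free, so T nabla_Z W - T nabla_W Z = T [Z, W],
    and everything reduces to: for Z, W in Dperp, [Z, W] lies in Dperp iff
    T [Z, W] = 0. Since T kills Dperp and xi, and is injective on Dtheta because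
    theta <> pi / 2, the kernel of T is Dperp + <xi>; and [Z, W] is orthogonal to
    xi because xi is parallel, whence nabla_Z W and nabla_W Z are.

    Both facts about the connection along M are checked in the frame of N given
    by the constant fields of a chart around iota p: expanding a field along M
    in this frame, the derivatives of the frame cancel by torsion-freeness on N,
    and the derivatives of the coefficients give [Z, W] by the symmetry of the
    second differential of iota. That symmetry is obtained in Young's form: h
    differentiable near a and its directional derivatives differentiable at a. *)

(** * Symmetry of second derivatives and smooth maps *)

Section Calculus.
Context {R : realType}.
Implicit Types E F G : normedModType R.

(** The first-order expansion at [a] only sees germs, so that of [f] serves for [g]. This is what
    lets a formula valid only inside a chart domain be differentiated. *)
Lemma near_eq_is_diff E F (f g : E -> F) (a : E) :
  (\forall x \near a, f x = g x) -> differentiable f a ->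
  differentiable g a /\ 'd g a = 'd f a :> (E -> F).
Proof.
move=> fg df.
have e : continuous ('d f a) /\ g \o shift a = cst (g a) + 'd f a +o_ 0 id.
  split; first exact: diff_continuous.
  apply/eqaddoP => e e0; have /eqaddoP /(_ e e0) := diff_locally df.
  apply: filter_app.
  have : \forall h \near (0:E), f (h + a) = g (h + a).
    by move: fg; rewrite (near_shift 0)/= subr0.
  apply: filter_app; near=> h => fgh.
  rewrite /= !fctE /= fgh; rewrite (nbhs_singleton fg) //.
have dE := diff_unique e.1 e.2.
split; last exact: dE.
by apply/diff_locallyP; rewrite dE.
Unshelve. all: by end_near. Qed.

Lemma diff_approx E F (f : E -> F) (a : E) (e : R) : differentiable f a -> 0 < e ->
  \forall h \near 0, `|f (a + h) - f a - 'd f a h| <= e * `|h|.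
Proof.
move=> df e0; have /eqaddoP /(_ e e0) := diff_locally df.
apply: filter_app; near=> h.
by rewrite /= !fctE /= [h + a]addrC opprD addrA.
Unshelve. all: by end_near. Qed.

Lemma is_derive_line E (h : E -> R^o) (b u : E) (x : R) :
  differentiable h (b + x *: u) ->
  is_derive x 1 (fun y : R => h (b + y *: u) : R) ('d h (b + x *: u) u).
Proof.
move=> dh.
have dl : is_diff x (fun y : R => b + y *: u) (fun y : R => y *: u).
  have := is_diffD (is_diff_cst b x) (is_diff_scalel x u).
  by move/is_diff_eq; apply; rewrite add0r.
have dl' := @ex_diff _ _ _ _ _ _ _ dl.
have dc := differentiable_comp dl' dh.
split; first exact: diff_derivable.
by rewrite deriveE // (diff_comp dl' dh) /= (@diff_val _ _ _ _ _ _ _ dl) scale1r.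
Qed.

(* Mean value theorem along u, then first-order expansion of 'd h . u at a. *)
Lemma second_difference E (h : E -> R^o) (a u v : E) (e : R) :
  (\forall x \near a, differentiable h x) ->
  differentiable (fun x => 'd h x u : R^o) a -> 0 < e ->
  \forall s \near 0^'+,
   `|(h (a + s *: v + s *: u) - h (a + s *: v) - h (a + s *: u) + h a)
     - s ^+ 2 * 'd (fun x => 'd h x u : R^o) a v| <=
   e * (2 * `|u| + `|v|) * s ^+ 2.
Proof.
move=> dh dD e0; set D := (fun x => _) in dD *.
have : \forall w \near 0, differentiable h (a + w) /\
    `|D (a + w) - D a - 'd D a w| <= e * `|w|.
  near=> w; split; last by near: w; exact: (diff_approx dD e0).
  near: w; move: dh; rewrite (near_shift 0)/= subr0.
  by apply: filter_app; near=> w; rewrite /= addrC.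
rewrite -nbhs_nearE => /nbhs_ballP[d /= d0 Hd].
have {}Hd w : `|w| < d -> differentiable h (a + w) /\
    `|D (a + w) - D a - 'd D a w| <= e * `|w|.
  by move=> wd; apply: Hd; rewrite -ball_normE /= sub0r normrN.
(* The [+ 1] keeps the divisor positive when [u] and [v] both vanish. *)
have uv0 : 0 < `|u| + `|v| + 1 by rewrite ltr_wpDl // addr_ge0.
near=> s.
have s0 : 0 < s by near: s; exact: nbhs_right_gt.
have sd : s * (`|u| + `|v| + 1) < d.
  by rewrite -ltr_pdivlMr //; near: s; apply: nbhs_right_lt; rewrite divr_gt0.
have small x y : 0 <= x <= s -> 0 <= y <= s -> `|x *: u + y *: v| < d.
  move=> /andP[x0 xs] /andP[y0 ys]; apply: le_lt_trans (ler_normD _ _) _.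
  rewrite !normrZ !ger0_norm //; apply: le_lt_trans sd.
  by have := normr_ge0 u; have := normr_ge0 v; nra.
(* The second difference is the increment of [G] over [[0, s]], and the derivative of [G] compares
   [D] at two points close to [a]. *)
pose G x : R := h (a + s *: v + x *: u) - h (a + x *: u).
have dG x : 0 <= x <= s ->
    is_derive x 1 G (D (a + s *: v + x *: u) - D (a + x *: u)).
  move=> xs; apply: is_deriveB; apply: is_derive_line.
    rewrite -addrA [s *: v + _]addrC; have [] // := Hd (x *: u + s *: v).
    by apply: small => //; rewrite lexx ltW.
  have [] // := Hd (x *: u).
  by have := small _ 0 xs; rewrite scale0r addr0; apply; rewrite lexx ltW.
have [||c cs GE] := @MVT R G (fun x => D (a + s *: v + x *: u) - D (a + x *: u)) 0 s s0.
- by move=> x; rewrite in_itv /= => /andP[x0 xs]; apply: dG; rewrite !ltW.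
- apply: derivable_within_continuous => x; rewrite in_itv /= => xs.
  by have [] := dG x xs.
move: cs; rewrite in_itv /= => /andP[c0 cs].
have -> : h (a + s *: v + s *: u) - h (a + s *: v) - h (a + s *: u) + h a = G s - G 0.
  by rewrite /G scale0r !addr0; ring.
rewrite GE subr0.
have cs' : 0 <= c <= s by rewrite !ltW.
have ss' : 0 <= s <= s by rewrite lexx ltW.
have zs' : 0 <= (0:R) <= s by rewrite lexx ltW.
have [_ H1] := Hd _ (small c s cs' ss').
have [_ H2] := Hd _ (small c 0 cs' zs').
rewrite scale0r addr0 in H2.
have eL : 'd D a (c *: u + s *: v) = (c * 'd D a u + s * 'd D a v :> R).
  by rewrite linearD !linearZ.
have eL2 : 'd D a (c *: u) = (c * 'd D a u :> R) by rewrite linearZ.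
rewrite eL in H1; rewrite eL2 in H2.
rewrite (_ : a + s *: v + c *: u = a + (c *: u + s *: v)); last first.
  by rewrite -addrA [s *: v + _]addrC.
have b1 : `|c *: u + s *: v| <= s * (`|u| + `|v|).
  rewrite (le_trans (ler_normD _ _))// !normrZ !gtr0_norm // mulrDr lerD2r.
  by rewrite ler_wpM2r // ltW.
have b2 : `|c *: u| <= s * `|u|.
  by rewrite normrZ gtr0_norm // ler_wpM2r // ltW.
(* The values of [D] and of its differential become arbitrary reals. The terms in [c * p] cancel,
   and the error bounds [s * (|u| + |v|)] and [s * |u|] add up to the constant [2 * |u| + |v|]. *)
suff key (A B C p q : R) :
    `|A - C - (c * p + s * q)| <= e * `|c *: u + s *: v| ->
    `|B - C - c * p| <= e * `|c *: u| ->
    `|(A - B) * s - s ^+ 2 * q| <= e * (2 * `|u| + `|v|) * s ^+ 2.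
  exact: key H1 H2.
move=> {}H1 {}H2.
have -> : (A - B) * s - s ^+ 2 * q = s * ((A - C - (c * p + s * q)) - (B - C - c * p)).
  by ring.
rewrite normrM (gtr0_norm s0).
rewrite (_ : e * _ * _ = s * (e * (s * (`|u| + `|v|)) + e * (s * `|u|))); last by ring.
rewrite ler_pM2l //.
rewrite (le_trans (ler_normB _ _))//.
by rewrite lerD // ?(le_trans H1) ?(le_trans H2) // ler_wpM2l // ltW.
Unshelve. all: by end_near. Qed.

(** The second difference is symmetric in [u] and [v], and both [s ^+ 2 * p] and [s ^+ 2 * q]
    approximate it up to an arbitrarily small multiple of [s ^+ 2]. *)
Lemma diff2_sym_scalar E (h : E -> R^o) (a u v : E) :
  (\forall x \near a, differentiable h x) ->
  differentiable (fun x => 'd h x u : R^o) a ->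
  differentiable (fun x => 'd h x v : R^o) a ->
  'd (fun x => 'd h x u : R^o) a v = 'd (fun x => 'd h x v : R^o) a u.
Proof.
move=> dh du dv; set p : R := LHS; set q : R := RHS.
apply/eqP; rewrite -subr_eq0 -normr_le0; apply/ler_addgt0Pr => e e0; rewrite add0r.
(* [3 * (|u| + |v|)] is the sum of the constants of the two estimates, so tolerance [e / K] in each
   gives [e] in total; the [+ 1] makes [K] positive. *)
pose K := 3 * (`|u| + `|v|) + 1.
have K0 : 0 < K by rewrite ltr_wpDl // mulr_ge0 // addr_ge0.
have eK : 0 < e / K by rewrite divr_gt0.
have [s [s0 [H1 H2]]] : exists s : R, 0 < s /\
   (`|(h (a + s *: v + s *: u) - h (a + s *: v) - h (a + s *: u) + h a)
     - s ^+ 2 * p| <= e / K * (2 * `|u| + `|v|) * s ^+ 2 /\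
   `|(h (a + s *: u + s *: v) - h (a + s *: u) - h (a + s *: v) + h a)
     - s ^+ 2 * q| <= e / K * (2 * `|v| + `|u|) * s ^+ 2).
  near (0 : R)^'+ => s; exists s; split; first by near: s; exact: nbhs_right_gt.
  split; near: s; exact: second_difference.
rewrite (_ : a + s *: u + s *: v = a + s *: v + s *: u) in H2; last first.
  by rewrite -!addrA [s *: u + _]addrC.
suff key (A B C D p' q' : R) :
    `|A - B - C + D - s ^+ 2 * p'| <= e / K * (2 * `|u| + `|v|) * s ^+ 2 ->
    `|A - C - B + D - s ^+ 2 * q'| <= e / K * (2 * `|v| + `|u|) * s ^+ 2 ->
    `|p' - q'| <= e.
  exact: key H1 H2.
move=> {}H1 {}H2.
have s2 : 0 < s ^+ 2 by rewrite exprn_gt0.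
rewrite -(ler_pM2l s2) -{1}(gtr0_norm s2) -normrM.
rewrite (_ : _ * (p' - q') =
  (A - C - B + D - s ^+ 2 * q') - (A - B - C + D - s ^+ 2 * p')); last by ring.
rewrite (le_trans (ler_normB _ _))//; apply: le_trans (lerD H2 H1) _.
rewrite -mulrDl -mulrDr mulrC ler_pM2l //.
rewrite mulrAC ler_pdivrMr // ler_pM2l // /K.
rewrite (_ : _ + _ + (_ + _) = 3 * (`|u| + `|v|)); last by ring.
by rewrite lerDl.
Unshelve. all: by end_near. Qed.

(** * Rules of differentiation and the algebra of smooth maps *)

Lemma diff_linear_comp E F G (L : {linear F -> G}) (f : E -> F) (a : E) :
  continuous L -> differentiable f a ->
  differentiable (L \o f) a /\ forall v, 'd (L \o f) a v = L ('d f a v).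
Proof.
move=> Lc df; have dL := linear_differentiable (f a) Lc.
split; first exact: differentiable_comp.
by move=> v; rewrite (diff_comp df dL) /= (diff_lin _ Lc).
Qed.

Lemma diff_scale E F (f : E -> R^o) (g : E -> F) (a : E) :
  differentiable f a -> differentiable g a ->
  differentiable (fun x => f x *: g x) a /\
  forall v, 'd (fun x => f x *: g x) a v = 'd f a v *: g a + f a *: 'd g a v.
Proof.
move=> df dg.
(* Scaling is packaged as a continuous bilinear map, so that the product rule becomes the chain rule
   through [diff_bilin]. *)
have sbil : bilinear_for (GRing.Scale.Law.clone _ _ *:%R _)
    (GRing.Scale.Law.clone _ _ *:%R _) (fun (k : R^o) (v : F) => k *: v).
  split=> [u'|u] b x y /=; first by rewrite scalerDl scalerA.
  by rewrite scalerDr !scalerA mulrC.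
pose sM := bilinear_isBilinear.Build R R^o F F _ _ _ sbil.
pose S : {bilinear R^o -> F -> F} := HB.pack (fun (k : R^o) (v : F) => k *: v) sM.
have Sc : continuous (fun p => S p.1 p.2).
  move=> p; apply: (@cvgZ _ F _ (nbhs p) _ fst snd); [exact: cvg_fst|exact: cvg_snd].
have dS := @differentiable_bilin _ _ _ _ S (f a, g a) Sc.
have dp := differentiable_pair df dg.
have -> : (fun x => f x *: g x) = (fun p => S p.1 p.2) \o (fun x => (f x, g x)) by [].
split; first exact: differentiable_comp.
move=> v; rewrite (diff_comp dp dS) /= (diff_bilin _ Sc) /= (diff_pair df dg) /=.
by rewrite addrC.
Qed.

Lemma diff_add E F (f g : E -> F) (a : E) :
  differentiable f a -> differentiable g a ->
  differentiable (fun x => f x + g x) a /\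
  forall v, 'd (fun x => f x + g x) a v = 'd f a v + 'd g a v.
Proof.
move=> df dg; split; first exact: (differentiableD df dg).
by move=> v; exact: (congr1 (fun h => h v) (diffD df dg)).
Qed.

(** Since [A] is open, agreement on [A] is agreement near each of its points, and passes to the
    differentials. *)
Lemma Ck_eq E F k (A : set E) (f g : E -> F) : open A ->
  (forall x, A x -> f x = g x) -> Ck k A f -> Ck k A g.
Proof.
move=> oA; elim: k f g => [|k IH] f g fg /=.
  move=> cf a Aa; have fga : \forall x \near a, f x = g x.
    by move: (open_nbhs_nbhs (conj oA Aa)); apply: filterS => x; exact: fg.
  rewrite /prop_for /continuous_at -(fg a Aa); apply: cvg_trans (cf a Aa).
  by apply: near_eq_cvg; exact: fga.
move=> [df Cf].
have dfg a : A a -> differentiable g a /\ 'd g a = 'd f a :> (E -> F).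
  move=> Aa; apply: near_eq_is_diff; last exact: df.
  by move: (open_nbhs_nbhs (conj oA Aa)); apply: filterS => x; exact: fg.
split; first by move=> a /dfg[].
move=> v; apply: IH (Cf v) => x Ax; exact: (esym (congr1 (fun d => d v) (dfg x Ax).2)).
Qed.

Lemma Ck_sub E F k (A B : set E) (f : E -> F) : B `<=` A -> Ck k A f -> Ck k B f.
Proof.
move=> BA; elim: k f => [|k IH] f /= Cf; first by move=> a /BA; exact: Cf.
by split=> [a /BA|v]; [exact: Cf.1|apply: IH; exact: Cf.2].
Qed.

Lemma CkW E F k (A : set E) (f : E -> F) : Ck k.+1 A f -> Ck k A f.
Proof.
elim: k f => [|k IH] f [df Cf].
  by move=> a Aa; apply: differentiable_continuous; exact: df.
by split=> // v; apply: IH; exact: Cf.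
Qed.

Lemma Ck_cst E F k (A : set E) (c : F) : Ck k A (fun=> c).
Proof.
elim: k c => [|k IH] c /=; first by move=> a _; exact: cvg_cst.
split=> [a _|v]; first exact: differentiable_cst.
rewrite (_ : (fun a => _) = (fun=> 0)); first exact: IH.
by apply/funext => a; rewrite diff_cst.
Qed.

Lemma CkD E F k (A : set E) (f g : E -> F) : open A ->
  Ck k A f -> Ck k A g -> Ck k A (fun x => f x + g x).
Proof.
move=> oA; elim: k f g => [|k IH] f g /=.
  by move=> cf cg a Aa; apply: continuousD; [exact: cf|exact: cg].
move=> [df Cf] [dg Cg]; split.
  by move=> a Aa; exact: (diff_add (df a Aa) (dg a Aa)).1.
move=> v; apply: Ck_eq (IH _ _ (Cf v) (Cg v)) => // x Ax.
by apply/esym; exact: (diff_add (df x Ax) (dg x Ax)).2.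
Qed.

Lemma CkZ E F k (A : set E) (f : E -> R^o) (g : E -> F) : open A ->
  Ck k A f -> Ck k A g -> Ck k A (fun x => f x *: g x).
Proof.
move=> oA; elim: k f g => [|k IH] f g.
  by move=> cf cg a Aa; apply: (@cvgZ _ F); [exact: cf|exact: cg].
move=> Cf' Cg'; have [df Cf] := Cf'; have [dg Cg] := Cg'.
split; first by move=> a Aa; apply: (diff_scale (df a Aa) (dg a Aa)).1.
move=> v.
(* The product rule pairs each derivative with the other factor undifferentiated, whose regularity
   must first be lowered by one order. *)
have CD := CkD oA (IH _ _ (Cf v) (CkW Cg')) (IH _ _ (CkW Cf') (Cg v)).
apply: Ck_eq CD => // x Ax.
by rewrite (diff_scale (df x Ax) (dg x Ax)).2.
Qed.

Lemma Ck_linear E F G k (A : set E) (L : {linear F -> G}) (f : E -> F) : open A ->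
  continuous L -> Ck k A f -> Ck k A (L \o f).
Proof.
move=> oA Lc; elim: k f => [|k IH] f /=.
  by move=> cf a Aa; apply: continuous_comp; [exact: cf|exact: Lc].
move=> [df Cf]; split; first by move=> a Aa; apply: (diff_linear_comp Lc (df a Aa)).1.
move=> v; apply: Ck_eq (IH _ (Cf v)) => // x Ax.
by rewrite (diff_linear_comp Lc (df x Ax)).2.
Qed.

Lemma smooth_at_near E F (f : E -> F) (a : E) :
  smooth_at f a -> \forall x \near a, smooth_at f x.
Proof.
move=> [A [oA Aa] CA]; near=> x; exists A => //; split=> //.
by near: x; exact: open_nbhs_nbhs.
Unshelve. all: by end_near. Qed.

Lemma smooth_at_differentiable E F (f : E -> F) (a : E) :
  smooth_at f a -> differentiable f a.
Proof. by move=> [A [oA Aa] /(_ 1%N)[+ _]]; exact. Qed.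

Lemma smooth_at_diff E F (f : E -> F) (a v : E) :
  smooth_at f a -> smooth_at (fun x => 'd f x v) a.
Proof. by move=> [A [oA Aa] CA]; exists A => // k; exact: (CA k.+1).2. Qed.

Lemma smooth_at_eq E F (f g : E -> F) (a : E) :
  (\forall x \near a, f x = g x) -> smooth_at f a -> smooth_at g a.
Proof.
rewrite -nbhs_nearE nbhsE => -[B [oB Ba] fg] [A [oA Aa] CA].
have oAB := openI oA oB.
exists (A `&` B) => // k; apply: (@Ck_eq _ _ _ _ f) => //; first by move=> x [_ /fg].
by apply: Ck_sub (CA k); exact: subIsetl.
Qed.

Lemma smooth_at_cst E F (c : F) (a : E) : smooth_at (fun=> c) a.
Proof. by exists setT; [split=> //; exact: openT|move=> k; exact: Ck_cst]. Qed.

Lemma smooth_at_common E F G (f : E -> F) (g : E -> G) (a : E) :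
  smooth_at f a -> smooth_at g a ->
  exists2 A, open_nbhs a A & (forall k, Ck k A f) /\ (forall k, Ck k A g).
Proof.
move=> [A [oA Aa] CA] [B [oB Ba] CB]; exists (A `&` B).
  by split=> //; exact: openI.
split=> k; first by apply: Ck_sub (CA k); exact: subIsetl.
by apply: Ck_sub (CB k); exact: subIsetr.
Qed.

Lemma smooth_atD E F (f g : E -> F) (a : E) :
  smooth_at f a -> smooth_at g a -> smooth_at (fun x => f x + g x) a.
Proof.
move=> /smooth_at_common h /h[A oA [CA CB]]; exists A => // k.
by apply: CkD => //; exact: oA.1.
Qed.

Lemma smooth_atZ E F (f : E -> R^o) (g : E -> F) (a : E) :
  smooth_at f a -> smooth_at g a -> smooth_at (fun x => f x *: g x) a.
Proof.
move=> /smooth_at_common h /h[A oA [CA CB]]; exists A => // k.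
by apply: CkZ => //; exact: oA.1.
Qed.

Lemma smooth_at_linear E F G (L : {linear F -> G}) (f : E -> F) (a : E) :
  continuous L -> smooth_at f a -> smooth_at (L \o f) a.
Proof.
move=> Lc [A [oA Aa] CA]; exists A => // k; exact: Ck_linear.
Qed.

Lemma smooth_at_sum E F n (f : 'I_n -> E -> F) (a : E) :
  (forall i, smooth_at (f i) a) -> smooth_at (fun x => \sum_(i < n) f i x) a.
Proof.
elim: n f => [|n IH] f sf.
  by under eq_fun do rewrite big_ord0; exact: smooth_at_cst.
under eq_fun do rewrite big_ord_recr.
by apply: smooth_atD => //; exact: IH.
Qed.

Lemma coord_linear m n i j : linear (fun A : 'M[R]_(m, n) => A i j : R^o).
Proof. by move=> c A B; rewrite !mxE. Qed.

Definition coord_lin m n i j : {linear 'M[R]_(m, n) -> R^o} :=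
  HB.pack (fun A : 'M[R]_(m, n) => A i j : R^o)
    (GRing.isLinear.Build _ _ _ _ _ (@coord_linear m n i j)).

Lemma coord_lin_continuous m n i j : continuous (@coord_lin m n i j).
Proof. exact: coord_continuous. Qed.

Lemma smooth_at_coord E n (f : E -> 'rV[R]_n) (a : E) i :
  smooth_at f a -> smooth_at (fun x => f x 0 i : R^o) a.
Proof. exact: (smooth_at_linear (@coord_lin_continuous 1 n 0 i)). Qed.

Lemma diff_coord E n (f : E -> 'rV[R]_n) (a : E) i : differentiable f a ->
  differentiable (fun x => f x 0 i : R^o) a /\
  forall v, 'd (fun x => f x 0 i : R^o) a v = ('d f a v) 0 i.
Proof. exact: (diff_linear_comp (@coord_lin_continuous 1 n 0 i)). Qed.

(** Coordinatewise reduction to the scalar case: near [a], taking a coordinate commutes with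
    differentiation. *)
Lemma diff2_sym E n (f : E -> 'rV[R]_n) (a u v : E) : smooth_at f a ->
  'd (fun x => 'd f x u) a v = 'd (fun x => 'd f x v) a u.
Proof.
move=> sf; apply/rowP => i.
have du := smooth_at_differentiable (smooth_at_diff u sf).
have dv := smooth_at_differentiable (smooth_at_diff v sf).
have nf : \forall x \near a, differentiable f x.
  by apply: filterS (smooth_at_near sf) => x; exact: smooth_at_differentiable.
have nc w : \forall x \near a,
    ('d f x w) 0 i = 'd (fun x => f x 0 i : R^o) x w.
  by apply: filterS nf => x /(diff_coord i)[_ ->].
rewrite -(diff_coord i du).2 -(diff_coord i dv).2.
have [du' eu] := near_eq_is_diff (nc u) (diff_coord i du).1.
have [dv' ev] := near_eq_is_diff (nc v) (diff_coord i dv).1.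
apply: etrans (etrans (esym (congr1 (fun d => d v) eu)) _) (congr1 (fun d => d u) ev).
apply: diff2_sym_scalar => //.
by apply: filterS nf => x /(diff_coord i)[].
Qed.

Lemma linear_row_sum F n (L : {linear 'rV[R]_n -> F}) (w : 'rV[R]_n) :
  L w = \sum_(j < n) w 0 j *: L (delta_mx 0 j).
Proof.
by rewrite {1}[w]row_sum_delta linear_sum; apply: eq_bigr => j _; rewrite linearZ.
Qed.

(** Expanding [Y] in the standard basis leaves derivatives in fixed directions, the only ones that
    [Ck] speaks of. *)
Lemma smooth_at_diff_app E n (h : 'rV[R]_n -> E) (Y : 'rV[R]_n -> 'rV[R]_n) a :
  smooth_at h a -> smooth_at Y a -> smooth_at (fun x => 'd h x (Y x)) a.
Proof.
move=> sh sY.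
rewrite (_ : (fun x => _) = (fun x => \sum_(j < n) Y x 0 j *: 'd h x (delta_mx 0 j))).
  apply: smooth_at_sum => j; apply: smooth_atZ; first exact: smooth_at_coord.
  exact: smooth_at_diff.
by apply/funext => x; exact: linear_row_sum.
Qed.

Lemma diff_sum E F n (f : 'I_n -> E -> F) (a : E) :
  (forall i, differentiable (f i) a) ->
  differentiable (fun x => \sum_(i < n) f i x) a /\
  forall v, 'd (fun x => \sum_(i < n) f i x) a v = \sum_(i < n) 'd (f i) a v.
Proof.
elim: n f => [|n IH] f df.
  rewrite (_ : (fun _ => _) = (fun=> 0)); last by apply/funext => x; rewrite big_ord0.
  split; first exact: differentiable_cst.
  by move=> v; rewrite big_ord0 (_ : 'd _ a = 0 :> (E -> F)) //; exact: diff_cst.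
rewrite (_ : (fun _ => _) =
  (fun x => \sum_(i < n) f (widen_ord (leqnSn n) i) x + f ord_max x)); last first.
  by apply/funext => x; rewrite big_ord_recr.
have [d1 e1] := IH (fun i => f (widen_ord (leqnSn n) i)) (fun i => df _).
have [d2 e2] := diff_add d1 (df ord_max).
split=> [|v]; first exact: d2.
apply: etrans (e2 v) _.
by rewrite big_ord_recr; congr (_ + _); exact: e1.
Qed.

(** The Leibniz rule for a moving Jacobian applied to a moving vector. *)
Lemma diff_diff_app F n (h : 'rV[R]_n -> F) (Y : 'rV[R]_n -> 'rV[R]_n) a v :
  smooth_at h a -> smooth_at Y a ->
  'd (fun x => 'd h x (Y x)) a v =
  'd (fun x => 'd h x (Y a)) a v + 'd h a ('d Y a v).
Proof.
move=> sh sY.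
(* Used for [Y] and for the constant field [Y a]: the sum depends on [Z a] only, hence is the same
   for both, and the remaining term vanishes for the constant field. *)
have expand (Z : 'rV[R]_n -> 'rV[R]_n) : smooth_at Z a ->
    'd (fun x => 'd h x (Z x)) a v = 'd h a ('d Z a v) +
      \sum_(j < n) Z a 0 j *: 'd (fun x => 'd h x (delta_mx 0 j)) a v.
  move=> sZ; have dZ := smooth_at_differentiable sZ.
  rewrite (_ : (fun x => _) =
    (fun x => \sum_(j < n) Z x 0 j *: 'd h x (delta_mx 0 j))); last first.
    by apply/funext => x; exact: linear_row_sum.
  have dt j := diff_scale (diff_coord j dZ).1
    (smooth_at_differentiable (smooth_at_diff (delta_mx 0 j) sh)).
  apply: etrans ((diff_sum (fun j => (dt j).1)).2 v) _.
  apply: etrans (congr1 (fun x => x + _) (esym (linear_row_sum ('d h a) ('d Z a v)))).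
  apply: etrans (big_split _ _ _ _ _); apply: eq_bigr => j _.
  apply: etrans ((dt j).2 v) _.
  by congr (_ *: _ + _); exact: (diff_coord j dZ).2.
apply: etrans (expand Y sY) _; rewrite addrC; congr (_ + _).
apply/esym; apply: etrans (expand (fun=> Y a) (smooth_at_cst _ _)) _.
have d0 : 'd (fun=> Y a) a v = 0 := congr1 (fun d => d v) (diff_cst (Y a) a).
apply: etrans (congr1 (fun w => 'd h a w + _) d0) _.
by apply: etrans (congr1 (fun w => w + _) (linear0 ('d h a))) _; exact: add0r.
Qed.

End Calculus.

(** * Charts and coordinate frames *)

Section Charts.
Context {R : realType} {n : nat} (M : manifold R n).
Implicit Types p q r : M.

Lemma dom_self p : dom p p.
Proof. exact: (dom_nbhs p).2. Qed.

Lemma near_dom p r : dom p r -> \forall q \near r, dom p q.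
Proof. by move=> pr; apply: open_nbhs_nbhs; split=> //; exact: (dom_nbhs p).1. Qed.

Lemma near_ichart p r (P : set M) : dom p r -> (\forall q \near r, P q) ->
  \forall a \near chart p r, P (ichart p a).
Proof.
move=> pr Pr; have := ichart_continuous pr.
by rewrite /prop_for /continuous_at chartK //; apply.
Qed.

Lemma near_ichartK p r : dom p r ->
  \forall a \near chart p r, chart p (ichart p a) = a.
Proof.
move=> pr.
have : nbhs (chart p r) (chart p @` dom p).
  by apply: open_nbhs_nbhs; split; [exact: chart_open|exists r].
by apply: filterS => _ [q pq <-]; rewrite chartK.
Qed.

Lemma transition_differentiable p q r : dom p r -> dom q r ->
  differentiable (chart q \o ichart p) (chart p r).
Proof. by move=> pr qr; apply: smooth_at_differentiable; exact: transition_smooth. Qed.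

(** Chain rule: near [chart p r], reading [f] through [ichart p] is reading it through [ichart q]
    after the transition map. *)
Lemma change_chart (F : normedModType R) (f : M -> F) p q r :
  dom p r -> dom q r -> differentiable (f \o ichart q) (chart q r) ->
  differentiable (f \o ichart p) (chart p r) /\
  forall v, 'd (f \o ichart q) (chart q r) ('d (chart q \o ichart p) (chart p r) v) =
    'd (f \o ichart p) (chart p r) v.
Proof.
move=> pr qr df; have dt := transition_differentiable pr qr.
have df' : differentiable (f \o ichart q) ((chart q \o ichart p) (chart p r)).
  by rewrite /= chartK.
have fE : \forall a \near chart p r,
    ((f \o ichart q) \o (chart q \o ichart p)) a = (f \o ichart p) a.
  apply: (@near_ichart p r (fun s => f (ichart q (chart q s)) = f s) pr).
  by apply: filterS (near_dom qr) => s qs; rewrite chartK.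
have [d1 e1] := near_eq_is_diff fE (differentiable_comp dt df').
split=> // v; apply: esym; apply: etrans (congr1 (fun d => d v) e1) _.
apply: etrans (congr1 (fun d => d v) (diff_comp dt df')) _.
by rewrite /= chartK.
Qed.

Lemma diff_chart_ichart p r v : dom p r ->
  'd (chart p \o ichart p) (chart p r) v = v.
Proof.
move=> pr; have [_ e] := near_eq_is_diff
  (filterS (fun a (H : chart p (ichart p a) = a) => esym H) (near_ichartK pr))
  (ex_diff : differentiable id (chart p r)).
apply: etrans (congr1 (fun d => d v) e) _.
exact: (congr1 (fun d => d v) (diff_val : 'd id (chart p r) = id :> (_ -> _))).
Qed.

Lemma components_self p v : components p p v = v.
Proof. exact: diff_chart_ichart (dom_self p). Qed.

Lemma in_chart_self (X : M -> 'rV[R]_n) p : in_chart X p (chart p p) = X p.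
Proof. by rewrite /in_chart (chartK (dom_self p)) components_self. Qed.

(* The field on the domain of the chart around p with constant components u. *)
Definition frame p (u : 'rV[R]_n) q : 'rV[R]_n :=
  'd (chart q \o ichart p) (chart p q) u.

Lemma frame_self p u : frame p u p = u.
Proof. exact: diff_chart_ichart (dom_self p). Qed.

(** The Jacobians of the two transitions between the charts of [p] and [q] are mutually inverse;
    each composition is [change_chart] applied to a chart. *)
Lemma components_frame p q u : dom p q -> components p q (frame p u q) = u.
Proof.
move=> pq; have dq := dom_self q.
apply: etrans ((change_chart (f := chart p) pq dq _).2 u) _.
  exact: transition_differentiable.
exact: diff_chart_ichart.
Qed.

Lemma frame_components p q v : dom p q -> frame p (components p q v) q = v.
Proof.
move=> pq; have dq := dom_self q.
apply: etrans ((change_chart (f := chart q) dq pq _).2 v) _.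
  exact: transition_differentiable.
exact: diff_chart_ichart.
Qed.

Lemma frame_sum p q u : frame p u q = \sum_(i < n) u 0 i *: frame p (delta_mx 0 i) q.
Proof. exact: linear_row_sum. Qed.

(** Constancy of the components near [p] gives, in turn, smoothness at [p], a zero differential and
    vanishing brackets of frame fields at [p]. *)
Lemma in_chart_frame p u : \forall a \near chart p p, u = in_chart (frame p u) p a.
Proof.
have pp := dom_self p.
have := near_ichart pp (near_dom pp).
by apply: filterS => a pa; rewrite /in_chart components_frame.
Qed.

Lemma frame_smooth p u : vf_smooth_at (frame p u) p.
Proof. exact: smooth_at_eq (in_chart_frame p u) (smooth_at_cst _ _). Qed.

Lemma diff_in_chart_frame p u v : 'd (in_chart (frame p u) p) (chart p p) v = 0.
Proof.
have [_ e] := near_eq_is_diff (in_chart_frame p u) (differentiable_cst u (chart p p)).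
apply: etrans (congr1 (fun d => d v) e) _.
exact: (congr1 (fun d => d v) (diff_cst u (chart p p))).
Qed.

Lemma lie_bracket_frame p u w : lie_bracket (frame p u) (frame p w) p = 0.
Proof.
apply: etrans (congr2 (fun x y => x - y) (diff_in_chart_frame p w _)
  (diff_in_chart_frame p u _)) _.
exact: subrr.
Qed.

End Charts.

(** * Fields along an immersion and the pullback connection *)

Section Immersion.
Context {R : realType} {k n : nat} {M : manifold R k} {N : manifold R n}.
Context {iota : M -> N} (hM : is_submanifold iota).
Implicit Types (p q : M) (V : M -> 'rV[R]_n) (X : M -> 'rV[R]_k).

(** The function whose smoothness [along_smooth_at] asserts, named so that it can be
    differentiated. *)
Definition along_chart V p (a : 'rV[R]_k) : 'rV[R]_n :=
  components (iota p) (iota (ichart p a)) (V (ichart p a)).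

Local Notation local_map p := (chart (iota p) \o iota \o ichart p).

Lemma near_iota p (P : set N) : (\forall r \near iota p, P r) ->
  \forall q \near p, P (iota q).
Proof. exact: (submanifold_continuous hM). Qed.

(** The tangent map is natural under changes of chart: one chain rule in [M] and one in [N] compare
    the charts centred at [q] and [iota q] with those of [p] and [iota p]. *)
Lemma iota_local_differentiable p q : dom p q -> dom (iota p) (iota q) ->
  differentiable (local_map p) (chart p q) ->
  forall w, components (iota p) (iota q) (tangent_map iota q w) =
    'd (local_map p) (chart p q) (components p q w).
Proof.
move=> pq ipq dl w; have dq := dom_self q.
pose f := chart (iota p) \o iota.
have [d1 e1] := change_chart (f := f) dq pq dl.
apply: esym; apply: etrans (e1 w) _.
have dt := transition_differentiable (dom_self (iota q)) ipq.
have dl' := smooth_at_differentiable (submanifold_smooth hM q).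
have dt' : differentiable (chart (iota p) \o ichart (iota q)) (local_map q (chart q q)).
  by rewrite /= chartK.
have fE : \forall a \near chart q q,
    ((chart (iota p) \o ichart (iota q)) \o local_map q) a = (f \o ichart q) a.
  pose P s := chart (iota p) (ichart (iota q) (chart (iota q) (iota s))) = f s.
  apply: (@near_ichart _ _ _ q q P dq).
  by apply: filterS (near_iota (near_dom (dom_self (iota q)))) => s qs; rewrite /P chartK.
have [_ e2] := near_eq_is_diff fE (differentiable_comp dl' dt').
apply: etrans (congr1 (fun d => d w) e2) _.
apply: etrans (congr1 (fun d => d w) (diff_comp dl' dt')) _.
by rewrite /= chartK.
Qed.

Lemma along_chart_tangent X p : \forall a \near chart p p,
  'd (local_map p) a (in_chart X p a) =
  along_chart (fun q => tangent_map iota q (X q)) p a.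
Proof.
have pp := dom_self p.
have sl := smooth_at_near (submanifold_smooth hM p).
have d1 := near_ichart pp (near_dom pp).
have d2 := near_ichart pp (near_iota (near_dom (dom_self (iota p)))).
near=> a.
have ca : chart p (ichart p a) = a by near: a; exact: near_ichartK.
have dl : differentiable (local_map p) (chart p (ichart p a)).
  by rewrite ca; apply: smooth_at_differentiable; near: a.
have pa : dom p (ichart p a) by near: a.
have ipa : dom (iota p) (iota (ichart p a)) by near: a.
have := iota_local_differentiable pa ipa dl (X (ichart p a)).
by rewrite ca /along_chart /in_chart => ->.
Unshelve. all: by end_near. Qed.

Lemma along_tangent_smooth X p : vf_smooth_at X p ->
  along_smooth_at iota (fun q => tangent_map iota q (X q)) p.
Proof.
move=> sX; apply: smooth_at_eq (along_chart_tangent X p) _.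
by apply: smooth_at_diff_app => //; exact: (submanifold_smooth hM).
Qed.

(** In charts, the image of [X] is the Jacobian of [iota] applied to the components of [X], so
    [diff_diff_app] splits off a second differential of [iota]. *)
Lemma diff_along_chart_tangent X p v : vf_smooth_at X p ->
  'd (along_chart (fun q => tangent_map iota q (X q)) p) (chart p p) v =
  'd (fun a => 'd (local_map p) a (X p)) (chart p p) v +
    tangent_map iota p ('d (in_chart X p) (chart p p) v).
Proof.
move=> sX; have sl := submanifold_smooth hM p.
have [_ e] := near_eq_is_diff (along_chart_tangent X p)
   (smooth_at_differentiable (smooth_at_diff_app sl sX)).
apply: etrans (congr1 (fun d => d v) e) _.
by apply: etrans (diff_diff_app v sl sX) _; rewrite in_chart_self.
Qed.

(** The second differentials of [iota] cancel by symmetry, and the Jacobian of the coordinate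
    bracket remains. *)
Lemma diff_along_chart_tangent_bracket X Y p :
  vf_smooth_at X p -> vf_smooth_at Y p ->
  'd (along_chart (fun q => tangent_map iota q (Y q)) p) (chart p p) (X p) -
  'd (along_chart (fun q => tangent_map iota q (X q)) p) (chart p p) (Y p) =
  tangent_map iota p (lie_bracket X Y p).
Proof.
move=> sX sY; have sl := submanifold_smooth hM p.
apply: etrans (congr2 (fun x y => x - y) (diff_along_chart_tangent (X p) sY)
  (diff_along_chart_tangent (Y p) sX)) _.
apply: etrans (congr1 (fun x => x + _ - _) (diff2_sym _ _ sl)) _.
rewrite opprD addrACA subrr add0r.
exact: (esym (linearB ('d (local_map p) (chart p p)) _ _)).
Qed.

Lemma dfun_comp (b : N -> R) p v : fun_smooth_at b (iota p) ->
  differentiable (b \o iota \o ichart p : 'rV[R]_k -> R^o) (chart p p) /\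
  dfun p (b \o iota) v = dfun (iota p) b (tangent_map iota p v).
Proof.
move=> sb; have pp := dom_self p; have dip := dom_self (iota p).
have dl := smooth_at_differentiable (submanifold_smooth hM p).
have db : differentiable (b \o ichart (iota p) : 'rV[R]_n -> R^o) (local_map p (chart p p)).
  by rewrite /= chartK //; exact: smooth_at_differentiable.
have fE : \forall a \near chart p p,
    ((b \o ichart (iota p)) \o local_map p) a = (b \o iota \o ichart p : _ -> R^o) a.
  pose P s := b (ichart (iota p) (chart (iota p) (iota s))) = b (iota s).
  apply: (@near_ichart _ _ _ p p P pp).
  by apply: filterS (near_iota (near_dom dip)) => s qs; rewrite /P chartK.
have [d2 e2] := near_eq_is_diff fE (differentiable_comp dl db).
split; first exact: d2.
apply: etrans (congr1 (fun d => d v) e2) _.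
apply: etrans (congr1 (fun d => d v) (diff_comp dl db)) _.
by rewrite /= chartK.
Qed.

End Immersion.

(** * Locality of the pullback connection and its coordinate formula *)

Section Pullback.
Context {R : realType} {k n : nat} {M : manifold R k} {N : manifold R n}.
Context {iota : M -> N} (hM : is_submanifold iota).
Context {nab : N -> 'rV[R]_n -> (N -> 'rV[R]_n) -> 'rV[R]_n}.
Context {nabM : M -> 'rV[R]_k -> (M -> 'rV[R]_n) -> 'rV[R]_n}.
Context (hnabM : is_pullback_connection iota nab nabM).
Implicit Types (p q : M) (V : M -> 'rV[R]_n).

Lemma along_smoothZ f V p : fun_smooth_at f p -> along_smooth_at iota V p ->
  along_smooth_at iota (fun q => f q *: V q) p.
Proof.
move=> sf sV; apply: smooth_at_eq (smooth_atZ sf sV).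
by near=> a; apply: esym; exact: linearZ.
Unshelve. all: by end_near. Qed.

Lemma along_smoothD V W p : along_smooth_at iota V p -> along_smooth_at iota W p ->
  along_smooth_at iota (fun q => V q + W q) p.
Proof.
move=> sV sW; apply: smooth_at_eq (smooth_atD sV sW).
by near=> a; apply: esym; exact: linearD.
Unshelve. all: by end_near. Qed.

Lemma along_smooth0 p : along_smooth_at iota (fun=> 0) p.
Proof.
apply: smooth_at_eq (smooth_at_cst 0 _).
by near=> a; apply: esym; exact: linear0.
Unshelve. all: by end_near. Qed.

Lemma along_smooth_sum m (V : 'I_m -> M -> 'rV[R]_n) p :
  (forall i, along_smooth_at iota (V i) p) ->
  along_smooth_at iota (fun q => \sum_(i < m) V i q) p.
Proof.
elim: m V => [|m IH] V sV.
  by under eq_fun do rewrite big_ord0; exact: along_smooth0.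
under eq_fun do rewrite big_ord_recr.
by apply: along_smoothD => //; exact: IH.
Qed.

Lemma pullback0 p v : nabM p v (fun=> 0) = 0.
Proof.
have := pullback_add hnabM v (along_smooth0 p) (along_smooth0 p).
under eq_fun do rewrite addr0.
by move/eqP; rewrite -subr_eq0 opprD addrA subrr add0r oppr_eq0 => /eqP.
Qed.

Lemma pullback_sum m (V : 'I_m -> M -> 'rV[R]_n) p v :
  (forall i, along_smooth_at iota (V i) p) ->
  nabM p v (fun q => \sum_(i < m) V i q) = \sum_(i < m) nabM p v (V i).
Proof.
elim: m V => [|m IH] V sV.
  by under eq_fun do rewrite big_ord0; rewrite big_ord0 pullback0.
under eq_fun do rewrite big_ord_recr.
rewrite big_ord_recr /= (pullback_add hnabM) //; last exact: along_smooth_sum.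
by rewrite IH.
Qed.

(* Smoothness at p only constrains germs, so the indicator function of a
   neighbourhood plays the role of a bump function. *)
Lemma pullback_local V W p v : along_smooth_at iota V p -> along_smooth_at iota W p ->
  (\forall q \near p, V q = W q) -> nabM p v V = nabM p v W.
Proof.
move=> sV sW VW; pose f q : R := \1_[set q | V q = W q] q.
have pp := dom_self p.
have sf : fun_smooth_at f p.
  apply: smooth_at_eq (smooth_at_cst (1 : R^o) (chart p p)).
  apply: (@near_ichart _ _ _ p p (fun q => 1 = f q) pp).
  by apply: filterS VW => q VWq; rewrite /f indicE mem_set.
have fp : f p = 1 by rewrite /f indicE mem_set //; exact: (nbhs_singleton VW).
have fE : (fun q => f q *: V q) = (fun q => f q *: W q).
  apply/funext => q; rewrite /f indicE.
  by case: (boolP (q \in _)) => [|_]; rewrite ?scale0r // inE /= => ->.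
have := pullback_leibniz hnabM v sf sV.
rewrite fE (pullback_leibniz hnabM v sf sW) fp !scale1r (nbhs_singleton VW).
by move/addrI.
Qed.

Lemma along_smooth_frame p u : along_smooth_at iota (frame (iota p) u \o iota) p.
Proof.
apply: smooth_at_eq (smooth_at_cst u _).
pose P q := u = components (iota p) (iota q) (frame (iota p) u (iota q)).
apply: (@near_ichart _ _ _ p p P (dom_self p)).
apply: filterS (near_iota hM (near_dom (dom_self _))) => q pq.
by rewrite /P components_frame.
Qed.

Lemma fun_smooth_along_coord V p i : along_smooth_at iota V p ->
  fun_smooth_at (fun q => components (iota p) (iota q) (V q) 0 i) p.
Proof. exact: smooth_at_coord. Qed.

(** The usual coordinate formula: derivative of the components plus a Christoffel term, obtained
    from the Leibniz rule in the frame of the chart around [iota p]. *)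
Lemma pullback_frame V p v : along_smooth_at iota V p ->
  nabM p v V = 'd (along_chart (iota := iota) V p) (chart p p) v +
    \sum_(i < n) V p 0 i *:
      nab (iota p) (tangent_map iota p v) (frame (iota p) (delta_mx 0 i)).
Proof.
move=> sV; pose c i q := components (iota p) (iota q) (V q) 0 i.
pose e i := frame (iota p) (delta_mx 0 i).
have sc i : fun_smooth_at (c i) p by exact: fun_smooth_along_coord.
have se i : along_smooth_at iota (e i \o iota) p by exact: along_smooth_frame.
have sce i := along_smoothZ (sc i) (se i).
(* The frame expansion of [V] is valid only where the chart is, hence the appeal to locality. *)
transitivity (nabM p v (fun q => \sum_(i < n) c i q *: (e i \o iota) q)).
  apply: pullback_local => //; first exact: along_smooth_sum.
  apply: filterS (near_iota hM (near_dom (dom_self _))) => q pq.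
  by rewrite -[LHS](frame_components (V q) pq) frame_sum.
rewrite pullback_sum //.
rewrite {1}['d _ _ v]row_sum_delta -big_split /=; apply: eq_bigr => i _.
rewrite (pullback_leibniz hnabM v (sc i) (se i)).
rewrite (pullback_restrict hnabM v (frame_smooth _ _)) /= /c components_self.
congr (_ *: _ + _); last exact: frame_self.
exact: (diff_coord i (smooth_at_differentiable sV)).2.
Qed.

End Pullback.

(** * Linearity of the metric and of a connection in its direction *)

Section Bilinear.
Context {R : realType} {n : nat} {N : manifold R n}.
Variable g : N -> 'M[R]_n.

Lemma app2_linear p w : linear (fun u => app2 g p u w : R^o).
Proof. by move=> a u v; rewrite /app2 !mulmxDl -!scalemxAl !mxE. Qed.

Definition app2_lin p w : {linear 'rV[R]_n -> R^o} :=
  HB.pack (fun u => app2 g p u w : R^o)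
    (GRing.isLinear.Build _ _ _ _ _ (app2_linear p w)).

Lemma app2_sum p m (u : 'I_m -> 'rV[R]_n) w :
  app2 g p (\sum_(i < m) u i) w = \sum_(i < m) app2 g p (u i) w.
Proof. exact: (linear_sum (app2_lin p w)). Qed.

Lemma app2D p u v w : app2 g p (u + v) w = app2 g p u w + app2 g p v w.
Proof. exact: (linearD (app2_lin p w)). Qed.

Lemma app2B p u v w : app2 g p (u - v) w = app2 g p u w - app2 g p v w.
Proof. exact: (linearB (app2_lin p w)). Qed.

Lemma app2Z p a u w : app2 g p (a *: u) w = a * app2 g p u w.
Proof. by rewrite /app2 -!scalemxAl mxE. Qed.

Lemma app20 p w : app2 g p 0 w = 0.
Proof. exact: (linear0 (app2_lin p w)). Qed.

Lemma app2_row_sum p (u w : 'rV[R]_n) :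
  app2 g p u w = \sum_(i < n) u 0 i * app2 g p (delta_mx 0 i) w.
Proof. exact: (linear_row_sum (app2_lin p w)). Qed.

Lemma app2r0 p w : app2 g p w 0 = 0.
Proof. by rewrite /app2 trmx0 mulmx0 mxE. Qed.

Lemma app2_eq0 p u : riemannian_metric g -> app2 g p u u = 0 -> u = 0.
Proof.
move=> hg u0; apply/eqP; apply: contraPT u0 => u0.
by apply/eqP; rewrite gt_eqF // metric_pos.
Qed.

Lemma connection_row_sum nab p u (Y : N -> 'rV[R]_n) :
  is_connection nab -> vf_smooth_at Y p ->
  nab p u Y = \sum_(j < n) u 0 j *: nab p (delta_mx 0 j) Y.
Proof.
move=> hc sY.
have lin : linear (fun u => nab p u Y).
  by move=> a v w; exact: (connection_linear hc).
pose L : {linear 'rV[R]_n -> 'rV[R]_n} :=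
  HB.pack (fun u => nab p u Y) (GRing.isLinear.Build _ _ _ _ _ lin).
exact: (linear_row_sum L).
Qed.

End Bilinear.

(** * Torsion and metric compatibility along the immersion *)

Section PullbackLeviCivita.
Context {R : realType} {k n : nat} {M : manifold R k} {N : manifold R n}.
Context {iota : M -> N} (hM : is_submanifold iota).
Context {g : N -> 'M[R]_n}.
Context {nab : N -> 'rV[R]_n -> (N -> 'rV[R]_n) -> 'rV[R]_n}.
Context {nabM : M -> 'rV[R]_k -> (M -> 'rV[R]_n) -> 'rV[R]_n}.
Context (hnabM : is_pullback_connection iota nab nabM).
Context (hnab : levi_civita g nab).
Implicit Types (p q : M) (V : M -> 'rV[R]_n).

Lemma levi_civita_frame_sym (r : N) (u v : 'rV[R]_n) :
  nab r u (frame r v) = nab r v (frame r u).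
Proof.
have := levi_civita_torsion hnab (frame_smooth r u) (frame_smooth r v).
by rewrite !frame_self lie_bracket_frame => /subr0_eq.
Qed.

(** Symmetry of the Christoffel symbols, extended from basis vectors by bilinearity; it cancels the
    Christoffel terms in the torsion along [M]. *)
Lemma frame_derivative_sym (r : N) (u v : 'rV[R]_n) :
  \sum_(i < n) u 0 i *: nab r v (frame r (delta_mx 0 i)) =
  \sum_(i < n) v 0 i *: nab r u (frame r (delta_mx 0 i)).
Proof.
have hc := levi_civita_connection hnab.
have expand w i := connection_row_sum w hc (frame_smooth r (delta_mx 0 i)).
under eq_bigr do rewrite expand scaler_sumr.
under [in RHS]eq_bigr do rewrite expand scaler_sumr.
rewrite exchange_big /=; apply: eq_bigr => i _; apply: eq_bigr => j _.
by rewrite levi_civita_frame_sym !scalerA mulrC.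
Qed.

Lemma pullback_torsion X Y p : vf_smooth_at X p -> vf_smooth_at Y p ->
  nabM p (X p) (fun q => tangent_map iota q (Y q)) -
  nabM p (Y p) (fun q => tangent_map iota q (X q)) =
  tangent_map iota p (lie_bracket X Y p).
Proof.
move=> sX sY; rewrite -(diff_along_chart_tangent_bracket hM sX sY).
rewrite (pullback_frame hM hnabM _ (along_tangent_smooth hM sY)).
rewrite (pullback_frame hM hnabM _ (along_tangent_smooth hM sX)).
rewrite (frame_derivative_sym _ (tangent_map iota p (X p))).
by rewrite opprD addrACA subrr addr0.
Qed.

(** This differentiates [g(V, xi) = 0]. Metric compatibility is given for fields on [N] only, so it
    is applied to the frame fields, where parallelism of [xi] removes the second term. *)
Lemma pullback_orth_parallel (xi : N -> 'rV[R]_n) V p v :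
  riemannian_metric g -> (forall r, vf_smooth_at xi r) ->
  (forall r w, nab r w xi = 0) -> along_smooth_at iota V p ->
  (\forall q \near p, app2 g (iota q) (V q) (xi (iota q)) = 0) ->
  app2 g (iota p) (nabM p v V) (xi (iota p)) = 0.
Proof.
move=> hg sxi xi0 sV V0.
pose e i := frame (iota p) (delta_mx 0 i).
pose b i r := app2 g r (e i r) (xi r).
have sb i : fun_smooth_at (b i) (iota p).
  by apply: (metric_smooth hg) => //; exact: frame_smooth.
have db i w : dfun (iota p) (b i) w =
    app2 g (iota p) (nab (iota p) w (e i)) (xi (iota p)).
  rewrite (levi_civita_metric hnab) //; last exact: frame_smooth.
  by rewrite xi0 app2r0 addr0.
rewrite (pullback_frame hM hnabM _ sV) app2D app2_sum app2_row_sum -big_split /=.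
pose c i a : R^o := along_chart (iota := iota) V p a 0 i.
have dc i := diff_coord i (smooth_at_differentiable sV).
have dbi i := dfun_comp hM v (sb i).
have dcb i := diff_scale (dc i).1 (dbi i).1.
have [ds es] := diff_sum (fun i => (dcb i).1).
have near0 : \forall a \near chart p p, 0 = \sum_(i < n)
    c i a *: (b i \o iota \o ichart p : _ -> R^o) a.
  pose P q := 0 = \sum_(i < n) components (iota p) (iota q) (V q) 0 i * b i (iota q).
  apply: (@near_ichart _ _ _ p p P (dom_self p)).
  have := near_iota hM (near_dom (dom_self (iota p))).
  apply: filterS2 V0 => q V0 pq; rewrite /P -[LHS]V0.
  rewrite -{1}(frame_components (V q) pq) frame_sum app2_sum.
  by apply: eq_bigr => i _; rewrite app2Z.
have [_ e0] := near_eq_is_diff near0 (differentiable_cst 0 _).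
have e00 := etrans (congr1 (fun d => d v) e0) (congr1 (fun d => d v) (diff_cst 0 _)).
(* Each summand is the product rule for [c i] times [b i \o iota], and the sum of these products
   vanishes near [p]. *)
apply: etrans (etrans (esym (es v)) e00); apply: eq_bigr => i _.
apply: esym; apply: etrans ((dcb i).2 v) _.
rewrite app2Z -db.
congr (_ * _ + _ * _).
- exact: (dc i).2.
- by rewrite /= /b (chartK (dom_self p)) /e frame_self.
- by rewrite /along_chart (chartK (dom_self p)) components_self.
- exact: (dbi i).2.
Qed.

End PullbackLeviCivita.

(** * The tangential projection and hemi-slant submanifolds *)

Section TangentialPart.
Context {R : realType} {k n : nat} {M : manifold R k} {N : manifold R n}.
Context {iota : M -> N} (hM : is_submanifold iota).
Context {g : N -> 'M[R]_n} (hg : riemannian_metric g).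
Implicit Types (p : M) (u w : 'rV[R]_k) (V W : 'rV[R]_n).

Lemma tangent_mapD p u w :
  tangent_map iota p (u + w) = tangent_map iota p u + tangent_map iota p w.
Proof. exact: linearD. Qed.

Lemma tangent_mapB p u w :
  tangent_map iota p (u - w) = tangent_map iota p u - tangent_map iota p w.
Proof. exact: linearB. Qed.

Lemma tangent_mapZ p a u : tangent_map iota p (a *: u) = a *: tangent_map iota p u.
Proof. exact: linearZ. Qed.

Lemma tangent_map0 p : tangent_map iota p 0 = 0.
Proof. exact: linear0. Qed.

Lemma tangent_map_gram_eq0 p u :
  app2 g (iota p) (tangent_map iota p u) (tangent_map iota p u) = 0 -> u = 0.
Proof.
move=> /(app2_eq0 hg) u0; apply: (submanifold_immersion hM (p := p)).
by rewrite u0 tangent_map0.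
Qed.

Lemma is_normalD p V W : is_normal iota g p V -> is_normal iota g p W ->
  is_normal iota g p (V + W).
Proof. by move=> nV nW w; rewrite app2D nV nW addr0. Qed.

(** Orthogonal projection by the normal equations: the Gram matrix [G] of the induced metric is
    invertible because the tangent map is injective and [g] is positive definite. *)
Lemma tan_part_exists p V : exists u, is_normal iota g p (V - tangent_map iota p u).
Proof.
pose J : 'M[R]_(k, n) := lin1_mx ('d (chart (iota p) \o iota \o ichart p) (chart p p)).
have JE w : w *m J = tangent_map iota p w by rewrite /J mul_rV_lin1.
pose G := J *m g (iota p) *m J^T.
have GE u w : (u *m G *m w^T) 0 0 =
    app2 g (iota p) (tangent_map iota p u) (tangent_map iota p w).
  by rewrite /app2 -!JE trmx_mul /G !mulmxA.
have Gu : G \in unitmx.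
  rewrite -row_free_unit; apply/inj_row_free => u uG.
  by apply: (@tangent_map_gram_eq0 p); rewrite -GE uG mul0mx mxE.
(* The solution [u] of [u *m G = V *m g (iota p) *m J^T]. *)
exists (V *m g (iota p) *m J^T *m invmx G) => w.
rewrite app2B -GE mulmxKV // /app2 -JE trmx_mul !mulmxA.
exact: subrr.
Qed.

Lemma tan_partP p V :
  is_normal iota g p (V - tangent_map iota p (tan_part iota g p V)).
Proof. exact: (getPex (tan_part_exists p V)). Qed.

(** The difference of two candidates has an image that is both tangent and normal, hence null for
    [g]. *)
Lemma tan_part_unique p V u :
  is_normal iota g p (V - tangent_map iota p u) -> tan_part iota g p V = u.
Proof.
move=> nu; apply/subr0_eq; apply: (@tangent_map_gram_eq0 p).
set d := tan_part _ _ _ _ - u.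
have dE : tangent_map iota p d = (V - tangent_map iota p u)
    - (V - tangent_map iota p (tan_part iota g p V)).
  by rewrite tangent_mapB opprB [RHS]addrC addrA subrK.
by rewrite {1}dE app2B nu tan_partP subrr.
Qed.

Lemma tan_part_tangent p u : tan_part iota g p (tangent_map iota p u) = u.
Proof. by apply: tan_part_unique => w; rewrite subrr app20. Qed.

Lemma tan_part_normal p V : is_normal iota g p V -> tan_part iota g p V = 0.
Proof. by move=> nV; apply: tan_part_unique; rewrite tangent_map0 subr0. Qed.

Lemma tan_partD p V W :
  tan_part iota g p (V + W) = tan_part iota g p V + tan_part iota g p W.
Proof.
apply: tan_part_unique; rewrite tangent_mapD opprD addrACA.
by apply: is_normalD; exact: tan_partP.
Qed.

Lemma TmapD phi p u w :
  Tmap iota phi g p (u + w) = Tmap iota phi g p u + Tmap iota phi g p w.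
Proof. by rewrite /Tmap -tan_partD tangent_mapD /app11 mulmxDl. Qed.

End TangentialPart.

(** First [phi^2 xi = 0]; then the formula for [phi^2] at [phi xi] gives [phi xi = c xi] with
    [c = eta(phi xi)]. Hence [c phi xi = phi^2 xi = 0], and applying [eta] yields [c^2 = 0]. *)
Lemma acm_phi_xi (R : realType) n (N : manifold R n) (phi : N -> 'M[R]_n) xi eta g p :
  almost_contact_metric phi xi eta g -> app11 phi p (xi p) = 0.
Proof.
move=> hN; have phi2 := acm_phi2 hN p.
have phi2xi : app11 phi p (app11 phi p (xi p)) = 0.
  by rewrite phi2 (acm_eta_xi hN) scale1r addNr.
have := phi2 (app11 phi p (xi p)); set c := app1 _ _ _.
rewrite phi2xi {1}/app11 mul0mx addrC => /esym/subr0_eq phixi.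
have cE : c *: app11 phi p (xi p) = 0.
  by rewrite -phi2xi -{2}phixi /app11 scalemxAl.
have : app1 eta p (c *: app11 phi p (xi p)) = c ^+ 2.
  rewrite -phixi scalerA /app1 -scalemxAl mxE -/(app1 eta p (xi p)).
  by rewrite (acm_eta_xi hN) mulr1.
rewrite cE /app1 mul0mx mxE => /esym/eqP; rewrite sqrf_eq0 => /eqP c0.
by rewrite -phixi c0 scale0r.
Qed.

(** * The kernel of [T] on a hemi-slant submanifold *)

Section HemiSlant.
Context {R : realType} {k n : nat} {M : manifold R k} {N : manifold R n}.
Context {iota : M -> N} (hM : is_submanifold iota).
Context {phi : N -> 'M[R]_n} {xi : N -> 'rV[R]_n} {eta : N -> 'cV[R]_n}.
Context {g : N -> 'M[R]_n} (hN : almost_contact_metric phi xi eta g).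
Context (hxi : xi_tangent iota xi) {Dtheta Dperp : M -> {vspace 'rV[R]_k}} {theta : R}.
Context (hD : hemi_slant iota phi xi g Dtheta Dperp theta).

Let hg := acm_riemannian hN.

Lemma Tmap_perp p u : u \in Dperp p -> Tmap iota phi g p u = 0.
Proof.
by move=> /(hemi_slant_totally_real hD) /(tan_part_normal hM hg).
Qed.

(** A nonzero [u] with [T u = 0] would have slant angle [acos 0 = pi / 2]; the quotient in the angle
    is [0] whatever its denominator. *)
Lemma Tmap_slant_eq0 p u : u \in Dtheta p -> Tmap iota phi g p u = 0 -> u = 0.
Proof.
move=> uD Tu; apply/eqP/negP => /negP u0.
apply: (hemi_slant_theta_neq hD); rewrite -(hemi_slant_slant hD uD u0).
rewrite /angle_with_tangent -/(Tmap iota phi g p u) Tu /induced_metric.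
by rewrite tangent_map0 app20 sqrtr0 mul0r acos0.
Qed.

(** Write [u = a + b + c x] along the splitting. As [T] kills [b] and [c x], also [T a = 0] and so
    [a = 0]; pairing with [xi] then forces [c = 0]. *)
Lemma Tmap_eq0_perp p u : Tmap iota phi g p u = 0 ->
  app2 g (iota p) (tangent_map iota p u) (xi (iota p)) = 0 -> u \in Dperp p.
Proof.
have [x xE] := hxi p.
have : u \in (Dtheta p + Dperp p + <[x]>)%VS.
  (* The third summand is spanned by the tangential part of [xi], which is [x] because [xi] is
     tangent. *)
  by rewrite -(tan_part_tangent hM hg p x) xE (hemi_slant_sum hD) memvf.
case/memv_addP => s /memv_addP[a aD [b bD ->]] [_ /vlineP[c ->] ->].
rewrite !(TmapD hM hg) (Tmap_perp bD) addr0.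
have -> : Tmap iota phi g p (c *: x) = 0.
  rewrite /Tmap tangent_mapZ xE /app11 -scalemxAl -/(app11 phi _ _).
  rewrite (acm_phi_xi _ hN) scaler0.
  by apply: (tan_part_normal hM hg) => w; rewrite app20.
rewrite addr0 => /(Tmap_slant_eq0 aD) ->; rewrite add0r.
rewrite tangent_mapD tangent_mapZ xE app2D (hemi_slant_Dperp_xi hD bD) add0r app2Z.
have xi0 : app2 g (iota p) (xi (iota p)) (xi (iota p)) != 0.
  apply/eqP => /(app2_eq0 hg) xi0; have := acm_eta_xi hN (iota p).
  by rewrite xi0 /app1 mul0mx mxE => /eqP; rewrite eq_sym oner_eq0.
move=> /eqP; rewrite mulf_eq0 (negPf xi0) orbF => /eqP ->.
by rewrite scale0r addr0.
Qed.

End HemiSlant.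

(** * The integrability criterion *)

Theorem theorem3p7 (R : realType) (m k : nat)
    (N : manifold R (m.*2).+1) (M : manifold R k)
    (phi : N -> 'M[R]_((m.*2).+1)) (xi : N -> 'rV[R]_((m.*2).+1))
    (eta : N -> 'cV[R]_((m.*2).+1)) (g : N -> 'M[R]_((m.*2).+1))
    (nab : N -> 'rV[R]_((m.*2).+1) -> (N -> 'rV[R]_((m.*2).+1)) ->
           'rV[R]_((m.*2).+1))
    (hN : cosymplectic phi xi eta g nab)
    (iota : M -> N) (hM : is_submanifold iota) (hxi : xi_tangent iota xi)
    (nabM : M -> 'rV[R]_k -> (M -> 'rV[R]_((m.*2).+1)) -> 'rV[R]_((m.*2).+1))
    (hnabM : is_pullback_connection iota nab nabM)
    (Dtheta Dperp : M -> {vspace 'rV[R]_k}) (theta : R)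
    (hD : hemi_slant iota phi xi g Dtheta Dperp theta) :
  integrable_distribution Dperp <->
  (forall (U : set M) (Z W : M -> 'rV[R]_k), open U ->
     section_on U Dperp Z -> section_on U Dperp W ->
     forall p, U p ->
       Tmap iota phi g p (induced_connection iota g nabM Z W p) =
       Tmap iota phi g p (induced_connection iota g nabM W Z p)).
Proof.
have hacm := cosymplectic_acm hN; have hg := acm_riemannian hacm.
have hnab := cosymplectic_levi_civita hN.
(* Projecting the torsion identity to [TM] recovers the bracket itself; both implications follow
   from this relation. *)
have bracketE Z W p : vf_smooth_at Z p -> vf_smooth_at W p ->
    Tmap iota phi g p (induced_connection iota g nabM Z W p) =
    Tmap iota phi g p (induced_connection iota g nabM W Z p) +
    Tmap iota phi g p (lie_bracket Z W p).
  move=> sZ sW; rewrite -(TmapD hM hg); congr Tmap.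
  rewrite -[lie_bracket Z W p](tan_part_tangent hM hg p) -(tan_partD hM hg).
  by rewrite -(pullback_torsion hM hnabM hnab sZ sW) addrC subrK.
split=> [intD U Z W oU sZ sW p Up|TE U Z W oU sZ sW p Up].
  rewrite (bracketE _ _ _ (sZ p Up).1 (sW p Up).1).
  by rewrite (Tmap_perp hM hacm hD (intD U Z W oU sZ sW p Up)) addr0.
have [sZp _] := sZ p Up; have [sWp _] := sW p Up.
apply: (Tmap_eq0_perp hM hacm hxi hD).
  by apply: (addrI (Tmap iota phi g p (induced_connection iota g nabM W Z p)));
     rewrite -bracketE // addr0; exact: TE oU sZ sW p Up.
(* The whole derivative along [M], before projection, is orthogonal to [xi]; so is the image of
   [[Z, W]], a difference of two such derivatives. *)
have orth X v : section_on U Dperp X ->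
    app2 g (iota p) (nabM p v (fun q => tangent_map iota q (X q))) (xi (iota p)) = 0.
  move=> sX; apply: (pullback_orth_parallel hM hnabM hnab) => //.
  - exact: (acm_xi_smooth hacm).
  - exact: (cosymplectic_xi hN).
  - exact: (along_tangent_smooth hM (sX p Up).1).
  - have := open_nbhs_nbhs (conj oU Up); apply: filterS => q Uq.
    exact: (hemi_slant_Dperp_xi hD (sX q Uq).2).
by rewrite -(pullback_torsion hM hnabM hnab sZp sWp) app2B !orth // subrr.
Qed.
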